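(* Let $K$ be a commutative ring with unit containing $\mathbb{Q}$, let $n\ge 1$, let $A=(A_{ij})_{1\le i,j\le n}$ be any $n\times n$ matrix with entries in $K$, let $1\le p\le n$, and let $I=\{i_1,\ldots,i_p\}$, $J=\{j_1,\ldots,j_p\}$ be two $p$-element subsets of $[n]=\{1,\ldots,n\}$ with $i_1<\cdots<i_p$ and $j_1<\cdots<j_p$. Then \[ \det(A_{I^{c},J^{c}})=(-1)^{\Sigma I+\Sigma J}\sum_{(\mathcal F,\mathcal R)\ \text{admissible}}\epsilon(\mathcal F)\prod_{j\in\mathcal R}\Big(\sum_{i=1}^n A_{ij}\Big)\prod_{(i,j)\in\mathcal F}(-A_{ij}), \] where the sum runs over all admissible pairs $(\mathcal F,\mathcal R)$ with $\mathcal F\subseteq[n]\times[n]$ and $\mathcal R\subseteq[n]$ (admissibility and $\epsilon(\mathcal F)$ being relative to $I$ and $J$).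
   Context: $A_{I^c,J^c}$ denotes the $(n-p)\times(n-p)$ matrix obtained from $A$ by deleting the rows with index in $I$ and the columns with index in $J$ (its determinant is $1$ if $p=n$). $\Sigma I=i_1+\cdots+i_p$, $\Sigma J=j_1+\cdots+j_p$. A forest is a set of 2-element subsets of $[n]$ such that the graph with vertex set $[n]$ and that edge set has no cycle. A directed forest is a set $\mathcal F$ of pairs $(u,v)\in[n]\times[n]$ with $u\ne v$, such that $(u,v)\in\mathcal F$ implies $(v,u)\notin\mathcal F$, and such that $\{\{u,v\}:(u,v)\in\mathcal F\}$ is a forest; $(u,v)$ is regarded as an edge oriented from $u$ to $v$. $\Pi_{\mathcal F}$ denotes the partition of $[n]$ into connected components of this undirected forest; inside each block, $\mathcal F$ restricts to a directed tree spanning the block. For a vertex $r$ of a block $C$, ''all edges of the tree on $C$ are oriented away from $r$'' means every $(u,v)\in\mathcal F$ with $u,v\in C$ has $u$ on the unique path in the tree from $r$ to $v$. A directed forest $\mathcal F$ is admissible (w.r.t. $I,J$) if: (i) every block $C\in\Pi_{\mathcal F}$ either satisfies $C\cap(I\cup J)=\emptyset$, or both $C\cap I$ and $C\cap J$ are singletons; (ii) in every block $C$ containing some $i\in I$ and $j\in J$, all edges of the tree on $C$ are oriented away from $j$. For admissible $\mathcal F$, $\sigma_{\mathcal F}$ is the unique permutation of $[p]$ such that for all $\alpha$, $j_\alpha$ and $i_{\sigma_{\mathcal F}(\alpha)}$ lie in the same block of $\Pi_{\mathcal F}$, and $\epsilon(\mathcal F)$ is the signature of $\sigma_{\mathcal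 F}$. A pair $(\mathcal F,\mathcal R)$ with $\mathcal F\subseteq[n]\times[n]$, $\mathcal R\subseteq[n]$ is admissible if: $\mathcal F$ is an admissible directed forest; every block $C\in\Pi_{\mathcal F}$ with $C\cap(I\cup J)=\emptyset$ contains exactly one element of $\mathcal R$, and $\mathcal R$ is contained in the union of such blocks; and in each such block $C$ all edges of the tree on $C$ are oriented away from the unique element of $C\cap\mathcal R$. *)

(* Defs.v *)
(* The vertex set [n] = {1, ..., n} is 'I_n = {0, ..., n - 1}. *)
From HB Require Import structures.
From mathcomp Require Import all_boot all_order all_fingroup all_algebra.

Set Implicit Arguments.
Unset Strict Implicit.
Unset Printing Implicit Defensive.

Import Order.TTheory GRing.Theory.

Local Open Scope ring_scope.

Section Subsets.

Variables n p : nat.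
Implicit Type S : {set 'I_n}.

(* The elements of S in increasing order (see elt_increasing). *)
Definition elt S (hS : #|S| = p) (a : 'I_p) : 'I_n :=
  enum_val (cast_ord (esym hS) a).

Lemma elt_increasing S (hS : #|S| = p) (a b : 'I_p) :
  (a < b)%N -> (elt hS a < elt hS b)%N.
Proof.
move=> ab; have x0 := elt hS a; rewrite /elt !(enum_val_nth x0) /=.
have sb : (b < size (enum S))%N by rewrite -cardE hS.
have sa : (a < size (enum S))%N by apply: ltn_trans ab sb.
suff so : sorted (fun x y : 'I_n => (x < y)%N) (enum S).
  have tr : transitive (fun x y : 'I_n => (x < y)%N).
    by move=> y x z; exact: ltn_trans.
  by exact: (sorted_ltn_nth tr x0 so).
rewrite {1}/enum_mem -enumT; apply: sorted_filter.
  by move=> y x z; exact: ltn_trans.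
have -> : sorted (fun x y : 'I_n => (x < y)%N) (enum 'I_n)
          = sorted ltn (map val (enum 'I_n)).
  by rewrite sorted_map.
by rewrite val_enum_ord; exact: iota_ltn_sorted.
Qed.

Lemma mem_elt S (hS : #|S| = p) (a : 'I_p) : elt hS a \in S.
Proof. exact: enum_valP. Qed.

Lemma elt_inj S (hS : #|S| = p) : injective (elt hS).
Proof. by move=> a b /enum_val_inj /cast_ord_inj. Qed.

Lemma elt_onto S (hS : #|S| = p) (x : 'I_n) :
  x \in S -> exists a, elt hS a = x.
Proof.
move=> xS; exists (cast_ord hS (enum_rank_in xS x)).
by rewrite /elt cast_ordK enum_rankK_in.
Qed.

(* Sum of the elements of S, in the 1-based labelling. *)
Definition index_sum S : nat := (\sum_(i in S) i.+1)%N.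

End Subsets.

Lemma card_compl n p (S : {set 'I_n}) : #|S| = p -> #|~: S| = (n - p)%N.
Proof. by move=> <-; rewrite cardsCs setCK card_ord. Qed.

Definition delete_mx (K : Type) n p (I J : {set 'I_n})
    (hI : #|I| = p) (hJ : #|J| = p) (A : 'M[K]_n) : 'M[K]_(n - p) :=
  mxsub (elt (card_compl hI)) (elt (card_compl hJ)) A.

Section Forests.

Variable n : nat.
Implicit Types (E : {set {set 'I_n}}) (F : {set 'I_n * 'I_n}).
Implicit Types (C I J R : {set 'I_n}).

Definition adj E : rel 'I_n := fun u v => [set u; v] \in E.

(* Cycles have pairwise distinct vertices, so bounding their length by n
   loses nothing (acyclicP). *)
Definition acyclic E : bool :=
  [forall k : 'I_n.+1, forall c : k.-tuple 'I_n,
     (2 < k)%N ==> ~~ ucycleb (adj E) c].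

Lemma acyclicP E :
  reflect (forall c : seq 'I_n, (2 < size c)%N -> ~ ucycle (adj E) c)
          (acyclic E).
Proof.
apply: (iffP forallP) => [H c c2 cyc | H k].
  have /andP[_ Uc] := cyc.
  have sc : (size c < n.+1)%N.
    by rewrite ltnS -[n in leqRHS]card_ord -(card_uniqP Uc) max_card.
  have /forallP/(_ (in_tuple c)) := H (Ordinal sc).
  by rewrite /= c2 /= => /negP; apply.
apply/forallP => c; apply/implyP => k2; apply/negP; apply: H.
by rewrite size_tuple.
Qed.

Definition is_forest E : bool :=
  [forall e in E, #|e| == 2%N] && acyclic E.

Definition undirected F : {set {set 'I_n}} :=
  [set [set e.1; e.2] | e in F].

Definition is_directed_forest F : bool :=
  [&& [forall e in F, e.1 != e.2],
      [forall e in F, (e.2, e.1) \notin F]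
    & is_forest (undirected F)].

(* The partition Pi_F of [n] into connected components. *)
Definition components F : {set {set 'I_n}} :=
  equivalence_partition (connect (adj (undirected F))) [set: 'I_n].

Definition same_block F (x y : 'I_n) : bool :=
  [exists C in components F, (x \in C) && (y \in C)].

(* u lies on a simple path from r to v; in a forest there is at most one such
   path.  The vertices other than r form the tuple t, so its length is < n;
   see on_pathP. *)
Definition on_path E (r v u : 'I_n) : bool :=
  [exists k : 'I_n, exists t : k.-tuple 'I_n,
     [&& path (adj E) r t, uniq (r :: t), last r t == v & u \in r :: t]].

Lemma on_pathP E (r v u : 'I_n) :
  reflect (exists t : seq 'I_n,
             [/\ path (adj E) r t, uniq (r :: t), last r t = v
               & u \in r :: t])
          (on_path E r v u).
Proof.
apply: (iffP existsP) => [[k /existsP[t /and4P[pt ut /eqP lt ur]]] | ].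
  by exists t.
move=> [t [pt ut lt ur]].
have st : (size t < n)%N.
  by rewrite -[n in ltnRHS]card_ord -[(size t).+1]/(size (r :: t))
             -(card_uniqP ut) max_card.
exists (Ordinal st); apply/existsP; exists (in_tuple t).
by apply/and4P; split=> //; apply/eqP.
Qed.

Definition oriented_away F C (r : 'I_n) : bool :=
  [forall e in F, (e.1 \in C) && (e.2 \in C) ==>
     on_path (undirected F) r e.2 e.1].

Definition avoids I J C : bool := C :&: (I :|: J) == set0.

Definition admissible_forest I J F : bool :=
  [&& is_directed_forest F,
      [forall C in components F,
         avoids I J C || (#|C :&: I| == 1%N) && (#|C :&: J| == 1%N)]
    & [forall C in components F, forall i in C :&: I, forall j in C :&: J,
         oriented_away F C j]].

Definition admissible_pair I J F R : bool :=
  [&& admissible_forest I J F,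
      [forall C in components F, avoids I J C ==> (#|C :&: R| == 1%N)],
      R \subset \bigcup_(C in components F | avoids I J C) C
    & [forall C in components F, avoids I J C ==>
         [forall r in C :&: R, oriented_away F C r]]].

End Forests.

Section Sign.

Variables (n p : nat) (I J : {set 'I_n}).
Hypotheses (hI : #|I| = p) (hJ : #|J| = p).
Implicit Type F : {set 'I_n * 'I_n}.

Definition links F (s : 'S_p) : bool :=
  [forall a : 'I_p, same_block F (elt hJ a) (elt hI (s a))].

(* The default value 1 is never used for admissible F (forest_permP). *)
Definition forest_perm F : 'S_p := odflt 1%g [pick s | links F s].

Definition forest_sign (K : pzRingType) F : K := (-1) ^+ forest_perm F.

Lemma forest_permP F : admissible_forest I J F ->
  links F (forest_perm F) /\ forall s, links F s -> s = forest_perm F.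
Proof.
case/and3P=> _ /forall_inP Hblk _.
have symE : symmetric (adj (undirected F)).
  by move=> x y; rewrite /adj setUC.
have eqc : {in [set: 'I_n] & &,
    equivalence_rel (connect (adj (undirected F)))}.
  move=> x y z _ _ _; split; first exact: connect0.
  move=> xy; have yx : connect (adj (undirected F)) y x.
    by rewrite (sym_connect_sym symE).
  by apply/idP/idP => h; [exact: connect_trans yx h | exact: connect_trans xy h].
have /and3P[/eqP cov /trivIsetP triv _] := equivalence_partitionP eqc.
rewrite -/(components F) in cov triv.
have blk x : exists2 C, C \in components F & x \in C.
  have: x \in cover (components F) by rewrite cov inE.
  by case/bigcupP=> C *; exists C.
have blkE x C D : C \in components F -> D \in components F ->
    x \in C -> x \in D -> C = D.
  move=> CF DF xC xD; apply/eqP; apply: contraT => CD.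
  by have /disjointFr/(_ xC) := triv _ _ CF DF CD; rewrite xD.
have one x C : C \in components F -> x \in C -> x \in I :|: J ->
    (#|C :&: I| == 1%N) && (#|C :&: J| == 1%N).
  move=> CF xC xIJ; have /orP[/eqP C0|//] := Hblk C CF.
  by have: x \in C :&: (I :|: J) by [rewrite inE xC]; rewrite C0 inE.
have uniqI x y z : x \in J -> y \in I -> z \in I ->
    same_block F x y -> same_block F x z -> y = z.
  move=> xJ yI zI /exists_inP[C CF /andP[xC yC]].
  case/exists_inP=> D DF /andP[xD zD].
  have zC : z \in C by rewrite (blkE x C D).
  have /andP[/cards1P[w Ew] _] : (#|C :&: I| == 1%N) && (#|C :&: J| == 1%N).
    by apply: (one x); rewrite // inE xJ orbT.
  have: y \in C :&: I by rewrite inE yC.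
  have: z \in C :&: I by rewrite inE zC.
  by rewrite Ew !inE => /eqP-> /eqP->.
have uniqJ x y z : x \in I -> y \in J -> z \in J ->
    same_block F y x -> same_block F z x -> y = z.
  move=> xI yJ zJ /exists_inP[C CF /andP[yC xC]].
  case/exists_inP=> D DF /andP[zD xD].
  have zC : z \in C by rewrite (blkE x C D).
  have /andP[_ /cards1P[w Ew]] : (#|C :&: I| == 1%N) && (#|C :&: J| == 1%N).
    by apply: (one x); rewrite // inE xI.
  have: y \in C :&: J by rewrite inE yC.
  have: z \in C :&: J by rewrite inE zC.
  by rewrite Ew !inE => /eqP-> /eqP->.
have ex a : {b | same_block F (elt hJ a) (elt hI b)}.
  apply: sigW; have [C CF jC] := blk (elt hJ a).
  have /andP[/cards1P[w Ew] _] : (#|C :&: I| == 1%N) && (#|C :&: J| == 1%N).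
    by apply: (one (elt hJ a)); rewrite // inE mem_elt orbT.
  have: w \in C :&: I by rewrite Ew inE.
  rewrite inE => /andP[wC /(elt_onto hI)[b Eb]].
  by exists b; apply/exists_inP; exists C; rewrite // jC Eb.
pose f a := sval (ex a).
have fP a : same_block F (elt hJ a) (elt hI (f a)) by exact: (svalP (ex a)).
have f_inj : injective f.
  move=> a b fab; apply: (@elt_inj n p J hJ).
  apply: (uniqJ (elt hI (f a))); rewrite ?mem_elt ?fP //.
  by rewrite fab fP.
have lf : links F (perm f_inj) by apply/forallP => a; rewrite permE.
have uni s t : links F s -> links F t -> s = t.
  move=> /forallP ls /forallP lt; apply/permP => a.
  apply: (@elt_inj n p I hI).
  by apply: (uniqI (elt hJ a)); rewrite ?mem_elt.
rewrite /forest_perm; case: pickP => [s ls | /(_ (perm f_inj))] /=.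
  by split=> // t lt; apply: uni.
by rewrite lf.
Qed.

End Sign.

(* Main.v *)
Require Import Defs.
From HB Require Import structures.
From mathcomp Require Import all_boot all_order all_fingroup all_algebra.

Set Implicit Arguments.
Unset Strict Implicit.
Unset Printing Implicit Defensive.

Import Order.TTheory GRing.Theory.

Local Open Scope ring_scope.

(* Up to the sign, the minor is the determinant of the matrix obtained from A
   by turning its columns j_a into the unit columns e_(i_a).  Expanding every
   other column v as S_v e_v + sum_(x <> v) (- A_xv) (e_v - e_x), where S_v is
   the sum of the column, gives a sum over the maps f that fix J pointwise, with
   f v = v recording the choice of S_v e_v.  The determinant attached to f
   vanishes if f has a cycle that is not a fixed point, for the sum of the
   columns along the cycle is zero.  Otherwise the graph of f is a forest rooted
   at its fixed points; left multiplication by the unitriangular matrix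
   [x leads to w under f] reduces the determinant to the p x p matrix
   [i_a leads to j_b], which is the matrix of the permutation linking J to I if
   the forest is admissible, and has a null row otherwise.  Conversely an
   admissible pair (F, R) comes from the map sending each vertex to its parent:
   two parents of the same vertex would close a cycle. *)

(** * Increasing enumerations and the sign of a shuffle *)

Lemma eq_elt n p (S : {set 'I_n}) (hS : #|S| = p) (f : 'I_p -> 'I_n) :
  {homo f : a b / (a < b)%N} -> (forall a, f a \in S) -> f =1 elt hS.
Proof.
move=> f_incr fS a.
pose ltI := fun x y : 'I_n => (x < y)%N.
have ltI_tr : transitive ltI by move=> y x z; exact: ltn_trans.
have ltI_irr : irreflexive ltI by move=> x; rewrite /ltI ltnn.
have srt (g : 'I_p -> 'I_n) : {homo g : a b / (a < b)%N} ->
    sorted ltI (map g (enum 'I_p)).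
  move=> g_incr; apply: (@homo_sorted _ _ g (fun a b : 'I_p => (a < b)%N) ltI) => //.
  have -> : sorted (fun a b : 'I_p => (a < b)%N) (enum 'I_p)
      = sorted ltn (map val (enum 'I_p)) by rewrite sorted_map.
  by rewrite val_enum_ord; exact: iota_ltn_sorted.
have inj (g : 'I_p -> 'I_n) : {homo g : a b / (a < b)%N} -> injective g.
  move=> g_incr b c gbc; case: (ltngtP b c) => [/g_incr|/g_incr|/val_inj//];
  by rewrite gbc ltnn.
have im (g : 'I_p -> 'I_n) : injective g -> (forall a, g a \in S) ->
    map g (enum 'I_p) =i S.
  move=> g_inj gS.
  have sub : {subset [set g a | a in 'I_p] <= S} by move=> _ /imsetP[b _ ->].
  have /eqP E : [set g a | a in 'I_p] == S.
    by rewrite eqEcard card_imset // card_ord hS leqnn andbT; exact/subsetP.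
  by move=> x; rewrite -[S]E; apply/mapP/imsetP => -[b _ ->]; exists b;
    rewrite ?mem_enum.
have el := @elt_increasing n p S hS.
have E : map f (enum 'I_p) = map (elt hS) (enum 'I_p).
  apply: (irr_sorted_eq ltI_tr ltI_irr) (srt _ f_incr) (srt _ el) _ => x.
  rewrite (im _ (inj _ f_incr) fS) (im _ (@elt_inj _ _ _ hS)) //.
  by move=> b; exact: mem_elt.
by move/eq_in_map: E; apply; rewrite mem_enum.
Qed.

Section Shuffle.

Variables n p : nat.
Implicit Type S : {set 'I_n}.

Definition shuffle_fun S (hS : #|S| = p) (u : 'I_p + 'I_(n - p)) : 'I_n :=
  match u with
  | inl a => elt hS a
  | inr b => elt (card_compl hS) b
  end.

Lemma shuffle_fun_inj S (hS : #|S| = p) : injective (shuffle_fun hS).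
Proof.
move=> [a|a] [b|b] /= E; try by rewrite (elt_inj E).
- by have := mem_elt (card_compl hS) b; rewrite -E inE mem_elt.
- by have := mem_elt (card_compl hS) a; rewrite E inE mem_elt.
Qed.

Lemma card_shuffle S : #|S| = p -> (p + (n - p))%N = n.
Proof. by move=> <-; rewrite subnKC // -[leqRHS]card_ord max_card. Qed.

(** The Grassmannian permutation of [S]: the first [p] positions list [S] and the others its
    complement, each increasingly. *)
Definition shuffle S (hS : #|S| = p) : 'S_n :=
  perm (inj_comp (shuffle_fun_inj (hS := hS))
    (inj_comp (can_inj (@splitK p (n - p)))
              (@cast_ord_inj _ _ (esym (card_shuffle hS))))).

(** The equation [e] is arbitrary, so that one cast can serve two different sets. *)
Lemma shuffleE S (hS : #|S| = p) (e : (p + (n - p))%N = n) u :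
  shuffle hS (cast_ord e (unsplit u)) = shuffle_fun hS u.
Proof.
by rewrite permE /=; congr shuffle_fun; rewrite -[RHS]unsplitK; congr split;
  apply: val_inj.
Qed.

(** Exchanging two consecutive labels alters only their own relative order, and [x], [y] lie on
    different sides of [S']. So the transposition carries the increasing lists of [S'] and of its
    complement to increasing lists. *)
Lemma shuffle_tperm S S' (hS : #|S| = p) (hS' : #|S'| = p) (x y : 'I_n) :
  y = x.+1 :> nat -> x \notin S -> y \in S -> S' = x |: (S :\ y) ->
  shuffle hS = (shuffle hS' * tperm x y)%g.
Proof.
move=> xy xS yS defS'.
have xney : x != y by rewrite -val_eqE /= xy neq_ltn ltnSn.
have memS' z : z \in S' = (tperm x y z \in S).
  rewrite defS' !inE; case: tpermP => [->|->|/eqP zx /eqP zy]; rewrite ?eqxx ?yS //.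
    by rewrite eq_sym (negPf xney) (negPf xS).
  by rewrite (negPf zx) zy.
have incr (z w : 'I_n) : (z \in S') = (w \in S') -> (z < w)%N ->
    (tperm x y z < tperm x y w)%N.
  rewrite !memS'; case: tpermP => [->|->|/eqP zx /eqP zy];
    case: tpermP => [->|->|/eqP wx /eqP wy]; rewrite ?(negPf xS) ?yS ?ltnn //.
  - move=> _; rewrite xy; rewrite ltn_neqAle => xw; rewrite ltn_neqAle.
    move: xw => /andP[_ xw]; move/eqP: wy => wy; move/eqP: wx => wx.
    have wx' : (x != w :> nat) by apply: contra_notN wx => /eqP/val_inj.
    have wy' : (y != w :> nat) by apply: contra_notN wy => /eqP/val_inj.
    rewrite -xy wy' /= xy ltn_neqAle wx'; exact: xw.
  - by move=> _; rewrite xy => /ltnW.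
  - by move=> _ /leq_trans; apply; rewrite xy.
  - move=> _; rewrite xy ltnS leq_eqVlt => /orP[/eqP/val_inj E|//].
    by rewrite E eqxx in zx.
apply/permP => k.
have e := card_shuffle hS.
have -> : k = cast_ord e (unsplit (split (cast_ord (esym e) k))).
  by rewrite splitK; apply: val_inj.
rewrite permM !shuffleE; case: split => [a|a] /=; symmetry;
  apply: (@eq_elt _ _ _ _ (tperm x y \o _)) => [b c bc /=|b /=].
- by apply: incr; rewrite ?mem_elt ?elt_increasing.
- by rewrite -memS' mem_elt.
- have N d : elt (card_compl hS') d \notin S'.
    by have := mem_elt (card_compl hS') d; rewrite inE.
  by apply: incr; rewrite ?elt_increasing ?(negPf (N _)).
- by rewrite inE -memS'; have := mem_elt (card_compl hS') b; rewrite inE.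
Qed.

Lemma down_closed_setE S : #|S| = p ->
  (forall x y : 'I_n, y = x.+1 :> nat -> y \in S -> x \in S) ->
  S = [set x : 'I_n | (x < p)%N].
Proof.
move=> hS down.
have downl (y x : 'I_n) : (x <= y)%N -> y \in S -> x \in S.
  case: y => y yn; elim: y yn => [|y IH] yn /=.
    rewrite leqn0 => /eqP x0 yS; suff -> : x = Ordinal yn by [].
    exact: val_inj.
  rewrite leq_eqVlt => /orP[/eqP E yS|].
    by suff -> : x = Ordinal yn by []; exact: val_inj.
  rewrite ltnS => xy yS; apply: (IH (ltnW yn)) => //.
  exact: (down (Ordinal (ltnW yn)) (Ordinal yn)).
set P := [set x : 'I_n | _].
have cP : #|P| = p.
  have e := card_shuffle hS.
  have inj := inj_comp (@cast_ord_inj _ _ e) (@lshift_inj p (n - p)).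
  rewrite -[RHS]card_ord -(card_imset predT inj); apply: eq_card => y.
  rewrite inE; apply/idP/imsetP => [yp|[a _ ->]]; last by rewrite /= ltn_ord.
  by exists (Ordinal yp) => //; apply: val_inj.
(* Down-closed sets are nested, so one of [S], [P] contains the other, and equal cardinals
   conclude. *)
apply/eqP; case: (boolP (S \subset P)) => [SP|/subsetPn[y yS]].
  by rewrite eqEcard SP cP hS leqnn.
rewrite inE -leqNgt => py; rewrite eq_sym eqEcard cP hS leqnn andbT.
apply/subsetP => z; rewrite inE => zp; apply: downl yS.
exact: ltnW (leq_trans zp py).
Qed.

Lemma shuffle_initial S (hS : #|S| = p) :
  S = [set x : 'I_n | (x < p)%N] -> shuffle hS = 1%g.
Proof.
move=> defS; have SE (x : 'I_n) : (x \in S) = (x < p)%N by rewrite defS inE.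
have e := card_shuffle hS.
apply/permP => k; rewrite perm1.
have {1}-> : k = cast_ord e (unsplit (split (cast_ord (esym e) k))).
  by rewrite splitK; apply: val_inj.
rewrite shuffleE; have := splitK (cast_ord (esym e) k).
case: split => [a|a] /= E.
  rewrite -(@eq_elt _ _ _ hS ( fun a => cast_ord e (lshift _ a))) //.
    by rewrite E; apply: val_inj.
  by move=> b; rewrite SE /= ltn_ord.
rewrite -(@eq_elt _ _ _ (card_compl hS) ( fun a => cast_ord e (rshift _ a))) //.
- by rewrite E; apply: val_inj.
- by move=> b c; rewrite /= ltn_add2l.
- by move=> b; rewrite inE SE /= -leqNgt leq_addr.
Qed.

Lemma index_sum_exchange S (x y : 'I_n) : y = x.+1 :> nat ->
  x \notin S -> y \in S -> index_sum S = (index_sum (x |: (S :\ y))).+1.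
Proof.
move=> xy xS yS; rewrite /index_sum (big_setD1 y) //= big_setU1 /=.
  by rewrite xy addSn.
by rewrite !inE (negPf xS) andbF.
Qed.

(** Induction on the sum of [S]: replacing some [y] of [S] by a missing predecessor [x] lowers the
    sum by one and composes the shuffle with a transposition. When no such pair is left, [S] is an
    initial segment and its shuffle is the identity. *)
Lemma odd_shuffle S (hS : #|S| = p) :
  odd_perm (shuffle hS) =
  odd (index_sum S) (+) odd (index_sum [set x : 'I_n | (x < p)%N]).
Proof.
move: {2}(index_sum S) (erefl (index_sum S)) => m.
elim: m S hS => [|m IH] S hS sumS.
all: case: (boolP [exists x : 'I_n, [exists y : 'I_n,
  [&& y == x.+1 :> nat, x \notin S & y \in S]]]) => [|no]; last first.
1,3: have defS : S = [set x : 'I_n | (x < p)%N].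
1,3: apply: down_closed_setE => // x y xy yS; apply: contraNT no => xS;
  by apply/existsP; exists x; apply/existsP; exists y; rewrite xy eqxx xS.
1,2: by rewrite shuffle_initial // -defS odd_perm1 addbb.
all: case/existsP=> x /existsP[y /and3P[/eqP xy xS yS]];
  move: (index_sum_exchange xy xS yS); rewrite sumS // => -[sumS'].
have hS' : #|x |: (S :\ y)| = p.
  by rewrite cardsU1 !inE (negPf xS) andbF -hS (cardsD1 y S) yS.
rewrite (shuffle_tperm hS hS' xy xS yS) // odd_permM odd_tperm (IH _ hS') //.
have -> : x != y.
  by apply: contraNneq xS => ->.
by rewrite addbT -sumS' addNb.
Qed.

End Shuffle.

(** * Minors through sorted block matrices *)

Section ShuffledDeterminant.

Variable R : comNzRingType.

Lemma det_mxsub_perm m n (e : m = n) (s t : 'S_n) (M : 'M[R]_n) :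
  \det (mxsub (fun k => s (cast_ord e k)) (fun k => t (cast_ord e k)) M) =
  (-1) ^+ (s (+) t) * \det M.
Proof.
subst m; have -> : mxsub (fun k => s (cast_ord erefl k))
    (fun k => t (cast_ord erefl k)) M = row_perm s (col_perm t M).
  by apply/matrixP => i j; rewrite !mxE !cast_ord_id.
rewrite row_permE col_permE !det_mulmx !det_perm odd_permV signr_addb.
by rewrite [\det M * _]mulrC mulrA.
Qed.

Section Blocks.

Variables (n p : nat) (I J : {set 'I_n}).
Hypotheses (hI : #|I| = p) (hJ : #|J| = p).
Implicit Type M : 'M[R]_n.

Lemma det_shuffle_mx M :
  \det M = (-1) ^+ (index_sum I + index_sum J) *
    \det (block_mx (mxsub (elt hI) (elt hJ) M)
                   (mxsub (elt hI) (elt (card_compl hJ)) M)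
                   (mxsub (elt (card_compl hI)) (elt hJ) M)
                   (delete_mx hI hJ M)).
Proof.
have e := card_shuffle hI.
set B := block_mx _ _ _ _.
have -> : B = mxsub (fun k => shuffle hI (cast_ord e k))
                    (fun k => shuffle hJ (cast_ord e k)) M.
  apply/matrixP => i j; rewrite [RHS]mxE -[i]splitK -[j]splitK !shuffleE /B.
  case: (split i) => a; case: (split j) => b /=;
  by rewrite ?block_mxEul ?block_mxEur ?block_mxEdl ?block_mxEdr mxE.
(* The parity of the initial segment enters both shuffle signs and cancels. *)
rewrite det_mxsub_perm !odd_shuffle mulrA -signr_odd -signr_addb oddD.
set x := odd _; set y := odd _; set z := odd _.
by case: x; case: y; case: z; rewrite mul1r.
Qed.

(** Only its values on [J] matter: they name the unit column that replaces each column of [J]. *)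
Definition match_perm : 'S_n := ((shuffle hJ)^-1 * shuffle hI)%g.

Lemma match_perm_elt a : match_perm (elt hJ a) = elt hI a.
Proof.
have e := card_shuffle hI; rewrite permM.
have sE (S : {set 'I_n}) (hS : #|S| = p) :
    shuffle hS (cast_ord e (unsplit (inl a))) = elt hS a by rewrite shuffleE.
by rewrite -{1}sE permK sE.
Qed.

(** Sorting rows by [I] and columns by [J] turns the unit columns into an identity block above a
    zero block, and leaves the minor in the lower right corner. *)
Lemma det_delete_mx (A : 'M[R]_n) :
  \det (delete_mx hI hJ A) = (-1) ^+ (index_sum I + index_sum J) *
    \det (\matrix_(w, v) if v \in J then (w == match_perm v)%:R else A w v).
Proof.
set B := \matrix_(w, v) _; rewrite (det_shuffle_mx B) mulrA -exprD addnn.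
rewrite -signr_odd odd_double mul1r.
have -> : mxsub (elt hI) (elt hJ) B = 1%:M.
  apply/matrixP => a b; rewrite !mxE mem_elt match_perm_elt.
  by rewrite (inj_eq (@elt_inj _ _ _ hI)).
have -> : mxsub (elt (card_compl hI)) (elt hJ) B = 0.
  apply/matrixP => a b; rewrite !mxE mem_elt match_perm_elt.
  case: eqP => // E; have := mem_elt (card_compl hI) a.
  by rewrite E inE mem_elt.
rewrite det_ublock det1 mul1r; congr (\det _).
apply/matrixP => a b; rewrite !mxE.
by have := mem_elt (card_compl hJ) b; rewrite inE => /negPf ->.
Qed.

End Blocks.

Lemma det_unit_columns n p (J : {set 'I_n}) (hJ : #|J| = p) (M : 'M[R]_n) :
  (forall w v, v \notin J -> M w v = (w == v)%:R) ->
  \det M = \det (mxsub (elt hJ) (elt hJ) M).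
Proof.
move=> MJ; rewrite (det_shuffle_mx hJ hJ) addnn -signr_odd odd_double mul1r.
have NJ b : elt (card_compl hJ) b \notin J.
  by have := mem_elt (card_compl hJ) b; rewrite inE.
have -> : mxsub (elt hJ) (elt (card_compl hJ)) M = 0.
  apply/matrixP => a b; rewrite !mxE MJ //; case: eqP => // E.
  by have := NJ b; rewrite -E mem_elt.
have -> : delete_mx hJ hJ M = 1%:M.
  apply/matrixP => a b; rewrite !mxE MJ //.
  by rewrite (inj_eq (@elt_inj _ _ _ (card_compl hJ))).
by rewrite det_lblock det1 mulr1.
Qed.

End ShuffledDeterminant.

(** * Orbits of a self-map *)

Section FunctionalDigraph.

Variable T : finType.
Implicit Type f : T -> T.

Lemma fconnect_step f x y : fconnect f x y -> x != y -> fconnect f (f x) y.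
Proof.
move=> xy; rewrite -(iter_findex xy); case: (findex f x y) => [|k].
  by rewrite eqxx.
by rewrite iterSr fconnect_iter.
Qed.

Lemma fconnect_fix f x y : f x = x -> fconnect f x y = (x == y).
Proof.
move=> fx; apply/idP/eqP => [/iter_findex <-|->]; last exact: connect0.
by elim: (findex f x y) => //= k <-.
Qed.

(** On a cycle [f] merely rotates the orbit; this makes the columns along the cycle telescope. *)
Lemma orbit_step f x : fconnect f (f x) x ->
  perm_eq (map f (fingraph.orbit f x)) (fingraph.orbit f x).
Proof.
move=> cyc; have cyc' : fcycle f (fingraph.orbit f x) by rewrite -fconnect_f.
have o : fingraph.order f (f x) = fingraph.order f x := (order_id_cycle cyc').
have -> : map f (fingraph.orbit f x) = fingraph.orbit f (f x).
  rewrite /fingraph.orbit o.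
  have tr k y : map f (traject f y k) = traject f (f y) k.
    by elim: k y => //= k IH y; rewrite IH.
  exact: tr.
have fx : f x \in fingraph.orbit f x by rewrite -fconnect_orbit fconnect1.
have [i ->] := orbit_rot_cycle cyc' (orbit_uniq f x) fx.
by rewrite perm_rot.
Qed.

(** Since [s] has finite order, [x] is a power of [s] applied to [s x], so [x] leads to [s x] as
    well as conversely. This is what makes the reachability matrix of an acyclic map unimodular. *)
Lemma fconnect_perm_antisym f (s : {perm T}) :
  antisymmetric (fconnect f) -> (forall x, fconnect f (s x) x) -> s = 1%g.
Proof.
move=> anti fs; apply/permP => x; rewrite perm1; apply: anti; rewrite fs /=.
have chain k y : fconnect f ((s ^+ k)%g y) y.
  elim: k y => [|k IH] y; first by rewrite expg0 perm1 connect0.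
  by rewrite expgS permM (connect_trans (IH _)).
have := chain (#[s]%g).-1 (s x).
by rewrite -permM -expgS prednK ?order_gt0 // expg_order perm1.
Qed.

End FunctionalDigraph.

(** * The matrix of a self-map and its determinant *)

Section FunctionalMatrix.

Variables (R : comNzRingType) (n : nat) (J : {set 'I_n}) (h : 'I_n -> 'I_n).
Implicit Types (f : {ffun 'I_n -> 'I_n}) (A : 'M[R]_n).

Definition fun_mx f : 'M[R]_n := \matrix_(w, v)
  if v \in J then (w == h v)%:R
  else if f v == v then (w == v)%:R else (w == v)%:R - (w == f v)%:R.

(** Columns in [J] are not expanded: the factor [(f v == v)%:R] allows a single choice there, so
    that sums may range over all functions. *)
Definition fun_weight A f : R := \prod_v
  if v \in J then (f v == v)%:R
  else if f v == v then \sum_i A i v else - A (f v) v.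

Lemma det_column_expansion (M : 'M[R]_n) :
  \det M = \sum_(s : 'S_n) (-1) ^+ s * \prod_v M (s v) v.
Proof.
rewrite -det_tr; apply: eq_bigr => s _; congr (_ * _).
by apply: eq_bigr => v _; rewrite mxE.
Qed.

(* The column v of A is expanded as
   S_v e_v + sum_(x <> v) (- A_xv) (e_v - e_x), where S_v is its sum. *)
Lemma det_fun_expansion A :
  \det (\matrix_(w, v) if v \in J then (w == h v)%:R else A w v) =
  \sum_f fun_weight A f * \det (fun_mx f).
Proof.
pose c v x : R := if v \in J then (x == v)%:R
  else if x == v then \sum_i A i v else - A x v.
pose U v x w : R := if v \in J then (w == h v)%:R
  else if x == v then (w == v)%:R else (w == v)%:R - (w == x)%:R.
have expand (v w : 'I_n) :
    (if v \in J then (w == h v)%:R else A w v) = \sum_x c v x * U v x w.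
  rewrite /c /U; case: ifP => vJ.
    rewrite (bigD1 v) //= eqxx mul1r big1 ?addr0 // => x /negPf ->.
    by rewrite mul0r.
  rewrite (bigD1 v) //= eqxx.
  rewrite [X in _ = _ + X](eq_bigr (fun x =>
    A x v * (w == x)%:R - A x v * (w == v)%:R)) => [|x /negPf ->]; last first.
    by rewrite mulNr mulrBr opprB.
  rewrite sumrB (bigD1 v) //= mulrDl -mulr_suml.
  (* On the diagonal the subtracted entries leave [A v v] of the column sum; off it only the term
     [x = w] survives. *)
  have [->|wv] := eqVneq w v.
    rewrite !mulr1 addrAC big1 ?sub0r ?add0r => [|x xv].
      by rewrite subrK.
    by rewrite eq_sym (negPf xv) mulr0.
  rewrite !mulr0 addr0 add0r subr0 (bigD1 w) //= eqxx mulr1 big1 ?addr0 //.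
  by move=> x /andP[_ xw]; rewrite eq_sym (negPf xw) mulr0.
rewrite det_column_expansion.
under eq_bigr => s _.
  under eq_bigr => v _ do rewrite mxE expand.
  rewrite bigA_distr_bigA /= mulr_sumr.
  over.
rewrite exchange_big /=; apply: eq_bigr => f _.
rewrite det_column_expansion mulr_sumr; apply: eq_bigr => s _.
rewrite big_split /= mulrCA; congr (_ * (_ * _)).
by apply: eq_bigr => v _; rewrite mxE.
Qed.

Lemma det_fun_mx_cyclic f : {in J, forall v, f v = v} ->
  (exists x, f x != x /\ fconnect f (f x) x) -> \det (fun_mx f) = 0.
Proof.
move=> fJ [x [fx cyc]].
(* A fixed point on the cycle would absorb it and make [x] itself fixed. Hence no vertex of the
   cycle lies in [J], and its columns are differences. *)
have orbN v : v \in fingraph.orbit f x -> f v != v.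
  move=> vo; apply: contra_neq fx => fv.
  have vx : fconnect f v x.
    by rewrite (fconnect_cycle _ vo) ?in_orbit // -fconnect_f.
  by move: vx; rewrite fconnect_fix // => /eqP <-.
pose c : 'cV[R]_n := \sum_(v <- fingraph.orbit f x) delta_mx v 0.
have Mc : fun_mx f *m c = 0.
  apply/matrixP => w i; rewrite ord1 mulmx_sumr summxE mxE.
  under eq_big_seq => v vo.
    have vJ : v \notin J by apply: contra (orbN v vo) => /fJ/eqP.
    rewrite -colE !mxE (negPf vJ) (negPf (orbN v vo)); over.
  rewrite sumrB -(big_map f xpredT (fun v => (w == v)%:R)).
  by rewrite (perm_big _ (orbit_step cyc)) subrr.
have cx : c x 0 = 1.
  rewrite summxE (big_rem x) /= ?in_orbit // mxE !eqxx big_seq big1 ?addr0 //.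
  move=> v; rewrite mxE mem_rem_uniq ?orbit_uniq // inE => /andP[vx _].
  by rewrite eq_sym (negPf vx).
(* The adjugate turns [Mc] into [\det (fun_mx f) *: c = 0]; the entry 1 of [c] avoids any division
   in [R]. *)
have := congr1 (fun M : 'cV_n => M x 0) (congr1 (mulmx (\adj (fun_mx f))) Mc).
by rewrite mulmxA mul_adj_mx mul_scalar_mx mulmx0 !mxE cx mulr1.
Qed.

Lemma det_fun_mx p (hJ : #|J| = p) f : antisymmetric (fconnect f) ->
  \det (fun_mx f) =
  \sum_(s : 'S_p | [forall a, fconnect f (h (elt hJ (s a))) (elt hJ a)]) (-1) ^+ s.
Proof.
move=> anti; pose P : 'M[R]_n := \matrix_(w, x) (fconnect f x w)%:R.
(* A nonzero Leibniz term needs [s w] to be reachable to [w] for all [w], which leaves only the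
   identity. *)
have detP : \det P = 1.
  rewrite /determinant (bigD1 1%g) //= odd_perm1 mul1r big1 => [|w _].
    rewrite big1 ?addr0 // => s s1.
    have [/forallP fs|/forallPn[w fw]] := boolP [forall w, fconnect f (s w) w].
      by rewrite (fconnect_perm_antisym anti fs) eqxx in s1.
    by rewrite (bigD1 w) //= mxE (negPf fw) mul0r mulr0.
  by rewrite mxE perm1 connect0.
(* For [v] outside [J] and not fixed, [v] and [f v] reach the same points except [v] itself, so the
   difference column becomes the unit column at [v]. *)
have PM w v : (P *m fun_mx f) w v =
    if v \in J then (fconnect f (h v) w)%:R else (w == v)%:R.
  have sumP y : \sum_x P w x * (x == y)%:R = (fconnect f y w)%:R.
    rewrite (bigD1 y) //= eqxx mulr1 big1 ?addr0 ?mxE // => x /negPf ->.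
    by rewrite mulr0.
  rewrite mxE; case: ifP => vJ.
    by rewrite -sumP; apply: eq_bigr => x _; rewrite [fun_mx f _ _]mxE vJ.
  have [fv|fv] := eqVneq (f v) v.
    rewrite [w == v]eq_sym -(fconnect_fix _ fv) -sumP.
    by apply: eq_bigr => x _; rewrite [fun_mx f _ _]mxE vJ fv eqxx.
  have -> : \sum_x P w x * fun_mx f x v =
      (fconnect f v w)%:R - (fconnect f (f v) w)%:R.
    rewrite -!sumP -sumrB; apply: eq_bigr => x _.
    by rewrite -mulrBr [fun_mx f _ _]mxE vJ (negPf fv).
  have [->|wv] := eqVneq w v.
    rewrite connect0; case: (boolP (fconnect f (f v) v)) => [c|_].
      by case/eqP: fv; apply: anti; rewrite c fconnect1.
    by rewrite subr0.
  case: (boolP (fconnect f v w)) => [c|c].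
    by rewrite fconnect_step ?subrr // eq_sym.
  case: (boolP (fconnect f (f v) w)) => [d|_]; last by rewrite subrr.
  by case/negP: c; apply: connect_trans d; exact: fconnect1.
rewrite -[LHS]mul1r -[X in X * _ = _]detP -det_mulmx (det_unit_columns hJ); last first.
  by move=> w v /negPf vJ; rewrite PM vJ.
rewrite /determinant [RHS]big_mkcond /=; apply: eq_bigr => s _.
under eq_bigr => a _ do rewrite [mxsub _ _ _ _ _]mxE PM mem_elt.
case: forallP => [fs|/forallP/forallPn[a fa]].
  by rewrite big1 ?mulr1 // => a _; rewrite fs.
by rewrite (bigD1 a) //= (negPf fa) mul0r mulr0.
Qed.

End FunctionalMatrix.

(** * The graph of a self-map *)

Lemma eq_set2 (T : finType) (a b u v : T) :
  ([set a; b] == [set u; v]) =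
  ((a == u) && (b == v)) || ((a == v) && (b == u)).
Proof.
apply/eqP/idP => [E|/orP[]/andP[/eqP-> /eqP->] //]; last by rewrite setUC.
have := set22 a b; have := set21 a b; rewrite {1 2}E !inE => au bu.
have := set22 u v; have := set21 u v; rewrite -E !inE; move: au bu.
by move=> /orP[]/eqP ? /orP[]/eqP ? /orP[]/eqP ? /orP[]/eqP ?; subst;
  rewrite ?eqxx ?orbT.
Qed.

Section ForestBlocks.

Variable n : nat.
Implicit Types (E : {set {set 'I_n}}) (F : {set 'I_n * 'I_n}).
Implicit Types (C I J R : {set 'I_n}) (f : 'I_n -> 'I_n).

Lemma adj_undirected F u v :
  adj (undirected F) u v = ((u, v) \in F) || ((v, u) \in F).
Proof.
rewrite /adj; apply/imsetP/orP => [[[a b] abF /= /eqP]|[]uvF].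
- by rewrite eq_set2 => /orP[]/andP[/eqP-> /eqP->]; [left|right].
- by exists (u, v).
- by exists (v, u); rewrite // setUC.
Qed.

Lemma adj_sym E : symmetric (adj E).
Proof. by move=> u v; rewrite /adj setUC. Qed.

Lemma connect_adj_sym E : connect_sym (adj E).
Proof. exact: sym_connect_sym (@adj_sym E). Qed.

Definition block F x : {set 'I_n} := [set y | connect (adj (undirected F)) x y].

Lemma componentsP F C :
  reflect (exists x, C = block F x) (C \in components F).
Proof.
apply: (iffP imsetP) => [[x _ ->]|[x ->]]; exists x => //;
by apply/setP => y; rewrite !inE.
Qed.

Lemma forall_componentsP F (P : pred {set 'I_n}) :
  reflect (forall x, P (block F x)) [forall C in components F, P C].
Proof.
apply: (iffP forall_inP) => [H x|H _ /componentsP[x ->] //].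
by apply: H; apply/componentsP; exists x.
Qed.

Lemma block_eq F x y : y \in block F x -> block F x = block F y.
Proof.
rewrite inE => xy; apply/setP => z; rewrite !inE.
by rewrite (same_connect (@connect_adj_sym _) xy).
Qed.

Lemma same_blockE F x y : same_block F x y = connect (adj (undirected F)) x y.
Proof.
apply/exists_inP/idP => [[_ /componentsP[z ->] /andP[]]|xy].
  by rewrite !inE connect_adj_sym; exact: connect_trans.
exists (block F x); last by rewrite !inE connect0.
by apply/componentsP; exists x.
Qed.

(** Each moved vertex receives one edge, from its image; edges thus point away from the fixed
    points, which are the roots. *)
Definition fun_forest f : {set 'I_n * 'I_n} :=
  [set e | (f e.2 == e.1) && (e.1 != e.2)].

Section Acyclic.

Variable f : 'I_n -> 'I_n.

Let E := undirected (fun_forest f).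

Lemma adj_fun_forest u v :
  adj E u v = (u != v) && ((f u == v) || (f v == u)).
Proof.
rewrite adj_undirected !inE /= [v == u]eq_sym -andb_orl andbC.
by congr (_ && _); rewrite orbC.
Qed.

(** Two points leading to each other lie on a cycle of [f] without fixed point. Length 2 would give
    two opposite edges, and a greater length a cycle of the graph. *)
Lemma fun_forest_antisym :
  is_directed_forest (fun_forest f) -> antisymmetric (fconnect f).
Proof.
case/and3P=> _ /forall_inP Fasym /andP[_ /acyclicP acyc] x y /andP[xy yx].
apply/eqP; apply: contraT => xney.
have cyc : fcycle f (fingraph.orbit f x).
  by rewrite -fconnect_f; apply: connect_trans yx; exact: fconnect_step.
have fx z : z \in fingraph.orbit f x -> f z != z.
  move=> zo; apply: contraNneq xney => fz.
  have zx : fconnect f z x by rewrite (fconnect_cycle cyc) ?in_orbit.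
  have zy := connect_trans zx xy.
  by move: zx zy; rewrite !fconnect_fix // => /eqP <-.
have sz : (2 < size (fingraph.orbit f x))%N.
  rewrite size_orbit ltn_neqAle; apply/andP; split.
    apply/eqP => o2.
    have ffx : f (f x) = x.
      by have := iter_order_cycle cyc (in_orbit f x) (in_orbit f x); rewrite -o2.
    have := Fasym (f x, x); rewrite !inE /= eqxx fx ?in_orbit // => /(_ isT).
    by rewrite ffx eqxx eq_sym fx ?in_orbit.
  rewrite ltn_neqAle fingraph.order_gt0 andbT; apply/eqP => o1.
  have := iter_order_cycle cyc (in_orbit f x) (in_orbit f x); rewrite -o1 /= => /eqP.
  by apply/negP; rewrite fx ?in_orbit.
case: (acyc _ sz); rewrite /ucycle orbit_uniq andbT.
apply: (sub_in_cycle (P := mem (fingraph.orbit f x)) _ _ cyc); last exact/allP.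
move=> z w zo wo /= /eqP <-; rewrite -/E adj_fun_forest eqxx andbT eq_sym.
exact: fx.
Qed.

Hypothesis anti : antisymmetric (fconnect f).

(** A potential decreasing at each proper step of [f]: it singles out a top vertex on a cycle and
    supports the induction towards a root. *)
Definition height x : nat := #|fconnect f x|.

Lemma height_lt x : f x != x -> (height (f x) < height x)%N.
Proof.
move=> fx; apply: proper_card; apply/properP; split.
  by apply/subsetP => y; apply: connect_trans; exact: fconnect1.
exists x; first exact: connect0.
apply: contra fx => fxx; apply/eqP/anti; rewrite inE in fxx.
by rewrite fxx fconnect1.
Qed.

(** In a cycle of the graph take a vertex [x] of greatest height. A neighbour sent to [x] by [f]
    would be higher, so both neighbours of [x] on the cycle equal [f x]. *)
Lemma is_directed_fun_forest : is_directed_forest (fun_forest f).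
Proof.
apply/and3P; split.
- by apply/forall_inP => e; rewrite inE => /andP[].
- apply/forall_inP => -[u v]; rewrite !inE /= => /andP[/eqP fv uv].
  apply/negP => /andP[/eqP fu _]; case/eqP: uv; apply: anti.
  by rewrite -{1}fu -fv !fconnect1.
apply/andP; split.
  apply/forall_inP => _ /imsetP[e + ->]; rewrite inE => /andP[_ e12].
  by rewrite cards2 e12.
apply/acyclicP => c c2 /andP[cyc Uc].
have [x0 x0c] : exists x, x \in c.
  by case: c c2 {cyc Uc} => // x c _; exists x; rewrite mem_head.
case: (arg_maxnP height x0c) => x xc max_x.
have up y : y \in c -> adj E x y -> y = f x.
  move=> /max_x hy; rewrite adj_fun_forest => /andP[xy /orP[/eqP//|/eqP fy]].
  by move: hy; rewrite /= leqNgt -fy height_lt // fy.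
have nx : next c x = f x by apply: up; rewrite ?mem_next ?next_cycle.
have px : prev c x = f x.
  by apply: up; rewrite ?mem_prev // adj_sym prev_cycle.
(* With [x] rotated to the front, its successor is the second entry and its predecessor the last;
   these differ in a duplicate-free list of length at least 3. *)
have [i s Ec] := rot_to xc.
move: nx px c2; rewrite -(next_rot i Uc) -(prev_rot i Uc) -(size_rot i) Ec.
move: Uc; rewrite -(rot_uniq i) Ec prev_nth mem_head /= => /andP[xs Us].
rewrite (memNindex xs) -last_nth.
case: s {Ec} xs Us => [|a [|b s]] //= _ /andP[aNs _] + Ea _.
by rewrite eqxx -Ea => E'; case/negP: aNs; rewrite E' mem_last.
Qed.

Lemma fun_root x : exists2 r, f r = r & fconnect f x r.
Proof.
have [m] := ubnP (height x); elim: m x => // m IH x; rewrite ltnS => hx.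
have [fx|fx] := eqVneq (f x) x; first by exists x; rewrite ?connect0.
have [r fr xr] := IH (f x) (leq_trans (height_lt fx) hx).
by exists r => //; apply: connect_trans xr; exact: fconnect1.
Qed.

Lemma fconnect_connect_adj x y : fconnect f x y -> connect (adj E) x y.
Proof.
case/connectP=> t; elim: t x => [|z t IH] x /=; first by move=> _ ->; exact: connect0.
case/andP=> /eqP <- zt yt; apply: connect_trans (IH _ zt yt).
have [->|fx] := eqVneq (f x) x; first exact: connect0.
by apply: connect1; rewrite adj_fun_forest eqxx eq_sym fx.
Qed.

(** One end of an edge is the image of the other, so both lead to the same fixed points; the
    property propagates along paths. *)
Lemma connect_adj_root r x : f r = r -> connect (adj E) x r = fconnect f x r.
Proof.
move=> fr; apply/idP/idP; last exact: fconnect_connect_adj.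
have step z : fconnect f (f z) r = fconnect f z r.
  apply/idP/idP => [|zr]; first by apply: connect_trans; exact: fconnect1.
  by have [->|zner] := eqVneq z r; rewrite ?fr ?connect0 ?fconnect_step.
case/connectP=> t; elim: t x => [|z t IH] x /=; first by move=> _ ->; exact: connect0.
case/andP=> xz zt rt; move: xz; rewrite adj_fun_forest.
case/andP=> _ /orP[]/eqP Ef; first by rewrite -step Ef IH.
by rewrite -Ef step IH.
Qed.

Lemma fconnect_root_uniq x r r' : f r = r -> f r' = r' ->
  fconnect f x r -> fconnect f x r' -> r = r'.
Proof.
move=> fr fr' xr xr'; apply/eqP; rewrite -(fconnect_fix r' fr).
rewrite -connect_adj_root //; apply: connect_trans _ (fconnect_connect_adj xr').
by rewrite connect_adj_sym fconnect_connect_adj.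
Qed.

(** The [f]-trajectory from [v] to [r] read backwards. That its vertices are reachable from [v]
    keeps the path simple in the induction; that it contains [f v] gives the orientation away from
    [r]. *)
Lemma simple_path_root r v : f r = r -> fconnect f v r ->
  exists t, [/\ path (adj E) r t, uniq (r :: t), last r t = v,
               {subset r :: t <= fconnect f v} & f v \in r :: t].
Proof.
move=> fr /iter_findex; move: (findex f v r) => k.
elim: k v => [|k IH] v; first move=> /= ->.
  exists [::]; rewrite fr mem_head; split=> // x.
  by rewrite inE => /eqP->; exact: connect0.
rewrite iterSr => /IH[t [pt Ut lt st fft]].
have [fv|fv] := eqVneq (f v) v.
  by exists t; rewrite fv in lt st fft; rewrite fv in fft; rewrite fv.
exists (rcons t v); rewrite -rcons_cons; split.
- by rewrite rcons_path pt lt adj_fun_forest fv eqxx orbT.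
- rewrite rcons_uniq Ut andbT; apply/negP => /st; rewrite inE => fvv.
  by case/eqP: fv; apply: anti; rewrite fvv fconnect1.
- by rewrite last_rcons.
- move=> x; rewrite mem_rcons inE => /orP[/eqP->|/st]; first exact: connect0.
  by apply: connect_trans; exact: fconnect1.
- by rewrite mem_rcons inE -{2}lt mem_last orbT.
Qed.

Lemma oriented_away_root r C : f r = r -> (forall x, x \in C -> fconnect f x r) ->
  oriented_away (fun_forest f) C r.
Proof.
move=> fr Cr; apply/forall_inP => -[u v]; rewrite inE /= => /andP[/eqP fv uv].
apply/implyP => /andP[_ /Cr vr].
have [t [pt Ut lt _]] := simple_path_root fr vr.
by rewrite fv => ut; apply/on_pathP; exists t.
Qed.

End Acyclic.

Lemma same_block_root f x r : antisymmetric (fconnect f) -> f r = r ->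
  same_block (fun_forest f) r x = fconnect f x r.
Proof.
by move=> anti fr; rewrite same_blockE connect_adj_sym connect_adj_root.
Qed.

End ForestBlocks.

(** * Admissible pairs as parent maps *)

Section AdmissibleForests.

Variable n : nat.
Implicit Types (E : {set {set 'I_n}}) (F : {set 'I_n * 'I_n}).
Implicit Types (C I J R : {set 'I_n}) (f : 'I_n -> 'I_n).

(** A simple path from [u] to [v] avoiding the edge has at least three vertices, and the edge closes
    it into a cycle. *)
Lemma acyclic_bridge E u v : acyclic E -> adj E u v -> u != v ->
  ~~ connect (adj (E :\ [set u; v])) u v.
Proof.
move=> /acyclicP acyc uv une; apply/negP => /connectP[q pq lq].
have : last u q = v by [].
case/shortenP: pq => t pt Ut _ lt.
case: t pt Ut lt => [|w [|w' t]] /= pt Ut lt; first by rewrite lt eqxx in une.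
  by move: pt; rewrite lt /adj !inE eqxx.
apply: (acyc [:: u, w, w' & t]) => //; rewrite /ucycle /= Ut andbT.
rewrite rcons_path lt [adj E v u]adj_sym uv andbT.
have sub : subrel (adj (E :\ [set u; v])) (adj E).
  by move=> x y; rewrite /adj inE => /andP[].
by case/and3P: pt => /sub -> /sub -> /(sub_path sub).
Qed.

(** The part of the simple path that stops at [u] does not meet [v], so it uses no edge at [v],
    whatever [w] is. *)
Lemma on_path_avoid E r v u w : on_path E r v u -> u != v ->
  connect (adj (E :\ [set w; v])) r u.
Proof.
move=> /on_pathP[t [pt Ut lt ut]] une.
case/splitPl: ut pt Ut lt => t1 t2 lt1.
rewrite cat_path -cat_cons cat_uniq last_cat lt1.
case/andP=> pt1 _ /and3P[_ Nt _] lt2.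
have vN : v \notin r :: t1.
  apply: contra Nt => vt1; apply/hasP; exists v => //.
  rewrite -lt2; case: t2 lt2 {pt1} => [/eqP|x t2 _]; first by rewrite (negPf une).
  by rewrite /= mem_last.
apply/connectP; exists t1 => //.
apply: (sub_in_path (P := mem (r :: t1)) _ _ pt1); last exact/allP.
move=> x y xt yt; rewrite /adj !inE => ->; rewrite andbT eq_set2.
by apply: contra vN => /orP[]/andP[/eqP xE /eqP yE]; [rewrite -yE|rewrite -xE].
Qed.

Definition is_source F r := oriented_away F (block F r) r.

Section Source.

Variables (F : {set 'I_n * 'I_n}) (r : 'I_n).
Hypotheses (Fdir : is_directed_forest F) (rsrc : is_source F r).

Let E := undirected F.

Let loopless u v : (u, v) \in F -> u != v.
Proof. by move=> uv; case/and3P: Fdir => /forall_inP/(_ _ uv). Qed.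

Let acycE : acyclic E.
Proof. by case/and3P: Fdir => _ _ /andP[]. Qed.

Let edge_adj u v : (u, v) \in F -> adj E u v.
Proof. by rewrite adj_undirected => ->. Qed.

Lemma source_on_path u v : (u, v) \in F -> connect (adj E) r v ->
  on_path E r v u.
Proof.
move=> uv rv; move: rsrc => /forall_inP/(_ _ uv)/implyP; apply; rewrite !inE rv andbT.
by apply: connect_trans rv _; rewrite connect_adj_sym connect1 ?edge_adj.
Qed.

(** The simple path from [r] to itself is trivial, so an edge into [r] would be a loop. *)
Lemma source_no_parent u : (u, r) \notin F.
Proof.
apply/negP => ur; have /on_pathP[t [_ Ut lt]] := source_on_path ur (connect0 _ _).
case: t Ut lt => [_ _|x t /= /andP[rN _] lt]; last by rewrite -{1}lt mem_last in rN.
by rewrite inE => /eqP E'; have := loopless ur; rewrite E' eqxx.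
Qed.

(** Otherwise [u] reaches [v] through [r] and [u'] without the edge between [u] and [v], although
    that edge is a bridge. *)
Lemma source_parent_uniq u u' v : connect (adj E) r v ->
  (u, v) \in F -> (u', v) \in F -> u = u'.
Proof.
move=> rv uv u'v; apply/eqP; apply: contraT => une.
have av w x : (x, v) \in F -> connect (adj (E :\ [set w; v])) r x.
  by move=> xv; apply: on_path_avoid (source_on_path xv rv) (loopless xv).
have /negP[] := acyclic_bridge acycE (edge_adj uv) (loopless uv).
apply: connect_trans (_ : connect _ u u') _.
  by apply: connect_trans (av _ _ u'v); rewrite connect_adj_sym av.
apply: connect1; have := edge_adj u'v; rewrite /adj !inE => ->; rewrite andbT.
rewrite eq_set2 [u' == u]eq_sym (negPf une) /=.
by apply: contra (loopless u'v) => /andP[].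
Qed.

(** The last edge of a simple path from [r] to [v] points to [v]: with the other orientation both
    its ends would be reachable from [r] without it, although it is a bridge. *)
Lemma source_parent_ex v : connect (adj E) r v -> v != r ->
  exists u, (u, v) \in F.
Proof.
case/connectP=> q pq lq vr; have : last r q = v by [].
case/shortenP: pq => t; case/lastP: t => [|t u'] pt Ut _ lt.
  by rewrite -lt eqxx in vr.
rewrite last_rcons in lt; subst u'; pose u := last r t.
move: pt; rewrite rcons_path -/u => /andP[pt uv].
have rt : on_path E r v u.
  apply/on_pathP; exists (rcons t v); rewrite rcons_path pt uv last_rcons.
  by split; rewrite // -rcons_cons mem_rcons inE mem_last orbT.
have une : u != v.
  move: Ut; rewrite -rcons_cons rcons_uniq => /andP[+ _].
  by apply: contraNneq => <-; exact: mem_last.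
move: uv; rewrite adj_undirected => /orP[uv|vu]; first by exists u.
have ru : connect (adj E) r u by apply/connectP; exists t.
have rv := on_path_avoid v (source_on_path vu ru) (loopless vu).
have /negP[] := acyclic_bridge acycE (edge_adj vu) (loopless vu).
apply: connect_trans (_ : connect _ v r) _; first by rewrite connect_adj_sym.
by rewrite setUC; exact: on_path_avoid rt une.
Qed.

End Source.

(** The default value turns vertices without incoming edge into fixed points. *)
Definition parent F v : 'I_n := odflt v [pick u | (u, v) \in F].

Lemma parent_fun_forest f : parent (fun_forest f) =1 f.
Proof.
move=> v; rewrite /parent; case: pickP => [u|/(_ (f v))] /=.
  by rewrite inE /= => /andP[/eqP].
by rewrite inE /= eqxx /= => /negbFE/eqP.
Qed.

Section Admissible.

Variables (I J : {set 'I_n}) (F : {set 'I_n * 'I_n}) (R : {set 'I_n}).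
Hypothesis adm : admissible_pair I J F R.

Let Fdir : is_directed_forest F. Proof. by case/and4P: adm => /and3P[]. Qed.

Lemma admissible_roots_disjoint v : v \in R -> v \notin J.
Proof.
move=> vR; case/and4P: adm => _ _ /subsetP/(_ v vR) /bigcupP[C].
case/andP=> _ /eqP avC vC _; apply: contraT => /negPn vJ.
by have := in_set0 v; rewrite -avC !inE vC vJ orbT.
Qed.

(** A block avoiding [I] and [J] is rooted at its element of [R], any other block at its element of
    [J]; neither kind contains a root of the other. *)
Lemma admissible_source x :
  exists r, [/\ connect (adj (undirected F)) r x, is_source F r, r \in J :|: R
   & forall y, connect (adj (undirected F)) r y -> y \in J :|: R -> y = r].
Proof.
case/and4P: adm => /and3P[_ /forall_componentsP blk /forall_componentsP oJ].
move=> /forall_componentsP cR RU /forall_componentsP oR.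
have [av|nav] := boolP (avoids I J (block F x)).
  have:= cR x; rewrite av /= => /cards1P[r Er].
  have: r \in block F x :&: R by rewrite Er inE.
  have := oR x; rewrite av => /forall_inP/(_ r) + rB; move=> /(_ rB).
  move: rB; rewrite inE => /andP[rx rR]; rewrite (block_eq rx) => src.
  exists r; split=> //; first by rewrite connect_adj_sym -[connect _ _ _]inE in rx *.
    by rewrite inE rR orbT.
  move=> y ry; rewrite inE => /orP[yJ|yR].
    have := in_set0 y; rewrite -(eqP av) (block_eq rx) !inE ry yJ orbT.
    by [].
  suff: y \in block F x :&: R by rewrite Er inE => /eqP.
  by rewrite (block_eq rx) !inE ry yR.
have := blk x; rewrite (negPf nav) => /andP[/cards1P[i Ei] /cards1P[r Er]].
(* The orientation away from [r] is only granted in the presence of an element of [I] in the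
   block. *)
have iB : i \in block F x :&: I by rewrite Ei inE.
have rB : r \in block F x :&: J by rewrite Er inE.
have := oJ x => /forall_inP/(_ i iB)/forall_inP/(_ r rB).
move: (rB); rewrite inE => /andP[rx rJ]; rewrite (block_eq rx) => src.
exists r; split=> //; first by move: rx; rewrite inE connect_adj_sym.
  by rewrite inE rJ.
move=> y ry; rewrite inE => /orP[yJ|yR].
  suff: y \in block F x :&: J by rewrite Er inE => /eqP.
  by rewrite (block_eq rx) !inE ry yJ.
case/bigcupP: (subsetP RU y yR) => _ /andP[/componentsP[z ->] /eqP av] yz.
have := in_set0 r; rewrite -av (block_eq yz) !inE rJ orbT andbT.
by rewrite connect_adj_sym ry.
Qed.

(** Parents being unique, the choice made by [parent] is forced and loses no edge. *)
Lemma admissible_parent u v : (parent F v == u) && (u != v) = ((u, v) \in F).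
Proof.
have [r [rv src _ _]] := admissible_source v.
rewrite /parent; case: pickP => [w wv|none] /=.
  apply/andP/idP => [[/eqP <-]//|uv].
  rewrite (source_parent_uniq Fdir src rv wv uv) eqxx; split=> //.
  by case/and3P: Fdir => /forall_inP/(_ _ uv).
rewrite none; apply/negbTE; rewrite negb_and negbK eq_sym; exact: orNb.
Qed.

Lemma admissible_roots v : (v \in J :|: R) = (parent F v == v).
Proof.
have [r [rv src rJR only]] := admissible_source v.
have [vr|vr] := eqVneq v r.
  rewrite vr rJR; symmetry; apply: contraTT isT => nr.
  have := source_no_parent Fdir src (parent F r).
  by rewrite -admissible_parent eqxx nr.
rewrite (_ : (v \in _) = false); last first.
  by apply: contraNF vr => /(only _ rv)->.
have [u uv] := source_parent_ex Fdir src rv vr.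
move: uv; rewrite -admissible_parent => /andP[/eqP -> uv].
by rewrite (negPf uv).
Qed.

Lemma fun_forest_parent : fun_forest (parent F) = F.
Proof. by apply/setP => -[u v]; rewrite inE /= admissible_parent. Qed.

End Admissible.

(** Fixed points in [J] are left out because [R] collects only the roots of blocks avoiding [I] and
    [J]. *)
Definition fun_roots J f : {set 'I_n} :=
  [set v | (v \notin J) && (f v == v)].

Lemma fun_roots_parent I J F R :
  admissible_pair I J F R -> fun_roots J (parent F) = R.
Proof.
move=> adm; apply/setP => v; rewrite inE -(admissible_roots adm) inE.
case vR: (v \in R); first by rewrite orbT (admissible_roots_disjoint adm).
by rewrite orbF andNb.
Qed.

End AdmissibleForests.

(** * Admissibility of the pair built from a map *)

Section FunctionForest.

Variables (n p : nat) (I J : {set 'I_n}) (hI : #|I| = p) (hJ : #|J| = p).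
Variable f : 'I_n -> 'I_n.

Lemma admissible_fun_fixed :
  admissible_pair I J (fun_forest f) (fun_roots J f) ->
  {in J, forall v, f v = v}.
Proof.
move=> adm v vJ; have := admissible_roots adm v.
by rewrite inE vJ parent_fun_forest => /esym/eqP.
Qed.

Hypotheses (anti : antisymmetric (fconnect f)) (fJ : {in J, forall v, f v = v}).

Lemma links_fun_forest s : links hI hJ (fun_forest f) s =
  [forall a, fconnect f (elt hI (s a)) (elt hJ a)].
Proof.
by apply: eq_forallb => a; rewrite same_block_root ?fJ ?mem_elt.
Qed.

(** Every block has one fixed point [r], and [s] being onto, every element of [I] leads to [J]. So a
    block with [r] in [J] contains one element of each set, and a block with [r] outside [J]
    contains none. *)
Lemma links_admissible s : links hI hJ (fun_forest f) s ->
  admissible_pair I J (fun_forest f) (fun_roots J f).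
Proof.
rewrite links_fun_forest => /forallP fs.
have rootI i : i \in I -> exists2 a, i = elt hI (s a) & fconnect f i (elt hJ a).
  case/(elt_onto hI) => b <-; exists ((s^-1)%g b); first by rewrite permKV.
  by have := fs ((s^-1)%g b); rewrite permKV.
have blockP x : exists r, [/\ f r = r, block (fun_forest f) x = block (fun_forest f) r
    & forall y, (y \in block (fun_forest f) r) = fconnect f y r].
  have [r fr xr] := fun_root anti x.
  have rE y : (y \in block (fun_forest f) r) = fconnect f y r.
    by rewrite inE connect_adj_sym connect_adj_root.
  by exists r; split=> //; apply/esym/block_eq; rewrite rE.
have fixB r y : f r = r -> f y = y -> fconnect f y r -> y = r.
  by move=> fr fy; rewrite fconnect_fix // => /eqP.
have IJ r : f r = r -> ~~ avoids I J (block (fun_forest f) r) -> r \in J.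
  move=> fr /set0Pn[y]; rewrite !inE connect_adj_sym connect_adj_root //.
  case/andP=> yr /orP[/rootI[a _ ya]|yJ].
    by rewrite (fconnect_root_uniq fr (fJ (mem_elt hJ a)) yr ya) mem_elt.
  by rewrite -(fixB _ _ fr (fJ yJ) yr).
have avJ r : f r = r -> avoids I J (block (fun_forest f) r) -> r \notin J.
  move=> fr /eqP av; apply/negP => rJ.
  by have := in_set0 r; rewrite -av !inE connect0 rJ orbT.
have away r : f r = r -> (forall y, (y \in block (fun_forest f) r) = fconnect f y r) ->
    oriented_away (fun_forest f) (block (fun_forest f) r) r.
  by move=> fr rE; apply: oriented_away_root => // y; rewrite rE.
apply/and4P; split; first (apply/and3P; split).
- exact: is_directed_fun_forest.
- apply/forall_componentsP => x; have [r [fr -> rE]] := blockP x.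
  case: (boolP (avoids _ _ _)) => //= /(IJ r fr) rJ.
  have [a Ea] := elt_onto hJ rJ.
  apply/andP; split; apply/cards1P.
    exists (elt hI (s a)); apply/setP => y; rewrite !inE -Ea connect_adj_sym.
    rewrite connect_adj_root ?fJ ?mem_elt //.
    apply/andP/eqP => [[ya /rootI[b Ey yb]]|->]; last by rewrite fs mem_elt.
    rewrite Ey; congr (elt hI (s _)); apply: (@elt_inj _ _ _ hJ).
    by apply: (fconnect_root_uniq _ _ yb ya); rewrite fJ ?mem_elt.
  exists r; apply/setP => y; rewrite in_setI rE inE; apply/andP/eqP => [[yr yJ]|->].
    exact: fixB (fJ yJ) yr.
  by rewrite connect0.
- apply/forall_componentsP => x; have [r [fr -> rE]] := blockP x.
  apply/forall_inP => i _; apply/forall_inP => j; rewrite in_setI rE => /andP[jr jJ].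
  by rewrite (fixB _ _ fr (fJ jJ) jr); exact: away.
- apply/forall_componentsP => x; have [r [fr -> rE]] := blockP x.
  apply/implyP => /(avJ r fr) rJ; apply/cards1P; exists r; apply/setP => y.
  rewrite in_setI rE !inE; apply/and3P/eqP => [[yr _ /eqP fy]|->]; first exact: fixB yr.
  by rewrite connect0 fr eqxx.
- apply/subsetP => v; rewrite inE => /andP[vJ /eqP fv].
  apply/bigcupP; exists (block (fun_forest f) v); last by rewrite inE connect0.
  apply/andP; split; first by apply/componentsP; exists v.
  by apply: contraNT vJ => /(IJ v fv).
- apply/forall_componentsP => x; have [r [fr -> rE]] := blockP x.
  apply/implyP => /(avJ r fr) rJ; apply/forall_inP => y.
  rewrite in_setI rE !inE => /and3P[yr _ /eqP fy].
  by rewrite (fixB _ _ fr fy yr); exact: away.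
Qed.

End FunctionForest.

(** * Weights and the final summation *)

Lemma fun_weightE (R : comNzRingType) n (J : {set 'I_n}) (A : 'M[R]_n)
    (f : {ffun 'I_n -> 'I_n}) : {in J, forall v, f v = v} ->
  fun_weight J A f =
  \prod_(j in fun_roots J f) (\sum_(i < n) A i j)
  * \prod_(e in fun_forest f) (- A e.1 e.2).
Proof.
move=> fJ; rewrite /fun_weight.
have -> : \prod_(e in fun_forest f) (- A e.1 e.2) =
    \prod_(v | f v != v) (- A (f v) v).
  (* An edge is determined by its head, which is any vertex moved by [f]. *)
  rewrite (reindex_onto (fun v => (f v, v)) snd) /= => [|[u v]]; last first.
    by rewrite inE /= => /andP[/eqP <-].
  by apply: eq_bigl => v; rewrite inE /= !eqxx andbT.
rewrite [X in _ = X * _]big_mkcond [X in _ = _ * X]big_mkcond -big_split /=.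
apply: eq_bigr => v _; rewrite inE.
case: (boolP (v \in J)) => [/fJ->|_]; first by rewrite eqxx mulr1.
by case: eqP; rewrite ?mulr1 ?mul1r.
Qed.

Lemma fun_weight_not_fixed (R : comNzRingType) n (J : {set 'I_n}) (A : 'M[R]_n)
    (f : {ffun 'I_n -> 'I_n}) v :
  v \in J -> f v != v -> fun_weight J A f = 0.
Proof.
by move=> vJ fv; rewrite /fun_weight (bigD1 v) //= vJ (negPf fv) mul0r.
Qed.

Theorem theorem1 (K : comAlgType rat) (n p : nat) (hn : (1 <= n)%N)
    (hp : (1 <= p <= n)%N) (A : 'M[K]_n) (I J : {set 'I_n})
    (hI : #|I| = p) (hJ : #|J| = p) :
  \det (delete_mx hI hJ A) =
  (-1) ^+ (index_sum I + index_sum J) *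
  \sum_(FR : {set 'I_n * 'I_n} * {set 'I_n} | admissible_pair I J FR.1 FR.2)
     forest_sign hI hJ K FR.1
     * \prod_(j in FR.2) (\sum_(i < n) A i j)
     * \prod_(e in FR.1) (- A e.1 e.2).
Proof.
rewrite det_delete_mx det_fun_expansion; congr (_ * _).
(* Admissible pairs are recovered from their parent map, so the sum is carried over to the maps [f]
   with admissible pair. *)
rewrite (reindex_onto (fun f : {ffun 'I_n -> 'I_n} => (fun_forest f, fun_roots J f))
  (fun FR => [ffun v => parent FR.1 v])) /=; last first.
  move=> [F R] /= adm; have E : [ffun v => parent F v] =1 parent F.
    by move=> v; rewrite ffunE.
  congr pair; last rewrite -(fun_roots_parent adm).
    by rewrite -[RHS](fun_forest_parent adm); apply/setP => e; rewrite !inE E.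
  by apply/setP => v; rewrite !inE E.
rewrite [RHS]big_mkcond /=; apply: eq_bigr => f _.
have -> : [ffun v => parent (fun_forest f) v] == f.
  by apply/eqP/ffunP => v; rewrite ffunE parent_fun_forest.
rewrite andbT; case: ifP => [adm|nadm].
  have fJ := admissible_fun_fixed adm.
  have admF : admissible_forest I J (fun_forest f) by case/and4P: adm.
  have anti : antisymmetric (fconnect f).
    by apply: fun_forest_antisym; case/and3P: admF.
  have [ls uniq_s] := forest_permP hI hJ admF.
  rewrite fun_weightE // (det_fun_mx _ _ hJ anti) -[RHS]mulrA [RHS]mulrC; congr (_ * _).
  (* The surviving permutations send each [a] so that the [s a]-th element of [I] leads to the
     [a]-th of [J]; this is [links], which has a unique solution. *)
  rewrite (big_pred1 (forest_perm hI hJ (fun_forest f))) // => s.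
  under eq_forallb => a do rewrite match_perm_elt.
  rewrite -(links_fun_forest hI hJ anti fJ).
  by apply/idP/eqP => [/uniq_s|->].
(* The remaining maps contribute zero: they move a point of [J], have a proper cycle, or admit no
   linking permutation. *)
have [/exists_inP[v vJ fv]|/exists_inPn fJ] :=
    boolP [exists v in J, f v != v].
  by rewrite (fun_weight_not_fixed _ vJ fv) mul0r.
have {}fJ : {in J, forall v, f v = v} by move=> v /fJ /negbNE/eqP.
have [/existsP[x /andP[fx cyc]]|/existsPn acyc] :=
    boolP [exists x, (f x != x) && fconnect f (f x) x].
  by rewrite (det_fun_mx_cyclic _ _ fJ) ?mulr0 //; exists x.
have anti : antisymmetric (fconnect f).
  move=> x y /andP[xy yx]; apply/eqP; apply: contraT => xney.
  have := acyc x; rewrite (connect_trans (fconnect_step xy xney) yx) andbT.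
  move/negbNE => /eqP fx; by rewrite fconnect_fix // (negPf xney) in xy.
rewrite (det_fun_mx _ _ hJ anti) big_pred0 ?mulr0 // => s.
under eq_forallb => a do rewrite match_perm_elt.
rewrite -(links_fun_forest hI hJ anti fJ); apply/negP => /(links_admissible anti fJ).
by rewrite nadm.
Qed.
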